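(* For every integer $n\ge 3$, the cycle $C_n$ of length $n$ satisfies $Z_g(C_n)=2$.
   Context: All graphs are finite and simple. The game: Let $G$ be a connected graph with at least one edge; initially all vertices are white. Alice (blue) and Bob (red) alternate turns, Alice first. On each turn the player makes exactly one move: a seed move (colour one white vertex with the player's colour) or a force move $u\to v$ (if a vertex $u$ of the player's colour has exactly one white neighbour $v$, colour $v$ with the player's colour). Being the unique white neighbour is with respect to all white vertices, irrespective of who coloured the others. If a white vertex is the target of one of the player's own legal forces, colouring it counts as a force move and not as a seed move. A move blocks a legal force $u\to v$ if that force is no longer legal after the move. Force Preservation Rule: considering the opponent's legal forces (those the opponent's coloured vertices could make) at the beginning of a turn, (i) a player may always perform one of their own legal forces, even if this blocks a force of the opponent; (ii) a seed move that blocks a legal force of the opponent is permitted only when every available seed move blocks at least one of the opponent's legal forces. The game ends when every vertex is coloured. Optimal play and $Z_g$: For a position $P$ define a set $\mathcal O(P)$ of pairs. If $P$ is terminal and Alice and Bob made $s_A$ and $s_B$ seed moves in total, then $\mathcal O(P)=\{(s_A,s_B)\}$. Otherwise let $\mathcal U(P)=\bigcup_m \mathcal O(P_m)$ over all legal moves $m$, where $P_m$ is the resulting position; $\mathcal O(P)$ is the set of all pairs in $\mathcal U(P)$ with minimum first coordinate if Alice is to move, and with minimum second coordinate if Bob is to move. Let $\mathcal O(G)=\mathcal O(P_0(G))$ for the initial position $P_0(G)$. The game zero forcing number is $Z_g(G)=\min\{s_A+s_B:(s_A,s_B)\in\mathcal O(G)\}$. *)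

(* Defs.v *)
From HB Require Import structures.
From mathcomp Require Import all_boot.

Set Implicit Arguments.
Unset Strict Implicit.
Unset Printing Implicit Defensive.

Record sgraph := SGraph {
  vertex :> finType;
  adj : rel vertex;
  adj_sym : symmetric adj;
  adj_irr : irreflexive adj }.

Definition connected_graph (G : sgraph) := forall u v : G, connect (@adj G) u v.
Definition has_edge (G : sgraph) := exists u v : G, adj u v.

(* [ordS i] is i + 1 modulo n.  The conjunct [i != j] only matters for n = 1,
   where it removes the loop. *)
Definition cycle_adj (n : nat) : rel 'I_n :=
  [rel i j | (i != j) && ((j == ordS i) || (i == ordS j))].

Lemma cycle_adj_sym n : symmetric (@cycle_adj n).
Proof. by move=> i j; rewrite /cycle_adj /= (eq_sym i) orbC. Qed.

Lemma cycle_adj_irr n : irreflexive (@cycle_adj n).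
Proof. by move=> i; rewrite /cycle_adj /= eqxx. Qed.

Definition cycle_graph (n : nat) : sgraph :=
  SGraph (@cycle_adj_sym n) (@cycle_adj_irr n).

Variant player := Alice | Bob.

Definition is_alice (p : player) := if p is Alice then true else false.
Definition player_of (b : bool) := if b then Alice else Bob.
Lemma is_aliceK : cancel is_alice player_of. Proof. by case. Qed.
HB.instance Definition _ := Equality.copy player (can_type is_aliceK).

Definition opponent (p : player) := if p is Alice then Bob else Alice.

(* [None] is white, [Some Alice] is blue, [Some Bob] is red. *)
Definition colouring (G : sgraph) := {ffun G -> option player}.

Section Moves.
Variable G : sgraph.
Implicit Types (c : colouring G) (p : player) (u v w : G).

Definition white c v : bool := c v == None.

Definition paint c p v : colouring G :=
  [ffun x => if x == v then Some p else c x].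

Definition legal_force c p u v : bool :=
  (c u == Some p) && ([set w | adj u w & white c w] == [set v]).

(* A move is determined by the vertex it colours: it is a force move if that
   vertex is the target of a legal force of the player, and a seed move
   otherwise. *)
Definition force_move c p v : bool := [exists u, legal_force c p u v].

Definition seed_move c p v : bool := white c v && ~~ force_move c p v.

Definition blocks c p v : bool :=
  [exists u, exists w, legal_force c (opponent p) u w
                       && ~~ legal_force (paint c p v) (opponent p) u w].

Definition permitted_seed c p v : bool :=
  seed_move c p v &&
  (blocks c p v ==> [forall w, seed_move c p w ==> blocks c p w]).

Definition legal_move c p v : bool := force_move c p v || permitted_seed c p v.

End Moves.

(* [seedsA] and [seedsB] count the seed moves made so far. *)
Record position (G : sgraph) := Position {
  col : colouring G;
  turn : player;
  seedsA : nat;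
  seedsB : nat }.

Definition initial (G : sgraph) : position G :=
  Position [ffun=> None] Alice 0 0.

Section Game.
Variable G : sgraph.
Implicit Types (P : position G) (v : G).

Definition play P v : position G :=
  let p := turn P in
  let s := seed_move (col P) p v in
  Position (paint (col P) p v) (opponent p)
    (seedsA P + (s && (p == Alice))) (seedsB P + (s && (p == Bob))).

Definition terminal P : bool := [forall v, ~~ white (col P) v].

Definition coord (p : player) (x : nat * nat) : nat :=
  if p is Alice then x.1 else x.2.

Definition best (p : player) (U : seq (nat * nat)) : seq (nat * nat) :=
  [seq x <- U | all (fun y => coord p x <= coord p y) U].

(* The recursion is on the number of white vertices, which each move decreases
   by one; [outcomesE] below is the defining equation free of this counter.
   A finite set of pairs is represented by a sequence listing its elements,
   possibly with repetitions. *)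
Fixpoint outcomes_rec (k : nat) P : seq (nat * nat) :=
  if k is k'.+1 then
    best (turn P)
      (flatten [seq outcomes_rec k' (play P v)
               | v <- enum (legal_move (col P) (turn P))])
  else [:: (seedsA P, seedsB P)].

Definition outcomes P : seq (nat * nat) :=
  outcomes_rec #|white (col P)| P.

Lemma legal_move_white c p v : @legal_move G c p v -> white c v.
Proof.
case/orP => [/existsP[u /andP[_ /eqP Ev]]|/andP[/andP[]//]].
by have := set11 v; rewrite -Ev inE => /andP[].
Qed.

Lemma card_white_paint c p v :
  white c v -> #|white c| = #|white (@paint G c p v)|.+1.
Proof.
move=> wv; rewrite (cardD1 v) [v \in _]wv add1n; congr _.+1.
by apply: eq_card => x; rewrite !inE unfold_in /white ffunE; case: eqP.
Qed.

Lemma outcomesE P :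
  outcomes P =
    if terminal P then [:: (seedsA P, seedsB P)]
    else best (turn P) (flatten [seq outcomes (play P v)
                                | v <- enum (legal_move (col P) (turn P))]).
Proof.
have -> : terminal P = (#|white (col P)| == 0).
  apply/forallP/eqP => [w|/card0_eq w x]; first by apply: eq_card0 => x; exact/negbTE/w.
  by rewrite -[white _ _]/(x \in white _) w.
rewrite /outcomes; case E: #|white (col P)| => [|k] //=.
congr (best _ (flatten _)); apply/eq_in_map => v.
rewrite mem_enum => /legal_move_white wv; congr (outcomes_rec _ _).
by move: E; rewrite (card_white_paint (turn P) wv) => -[].
Qed.

Lemma legal_move_exists P : ~~ terminal P ->
  exists v, legal_move (col P) (turn P) v.
Proof.
rewrite negb_forall => /existsP[v]; rewrite negbK => wv.
set c := col P; set p := turn P.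
have [fv|nfv] := boolP (force_move c p v); first by exists v; apply/orP; left.
have sv : seed_move c p v by rewrite /seed_move wv nfv.
have [/forallP a|] := boolP [forall w, seed_move c p w ==> blocks c p w].
  exists v; apply/orP; right; rewrite /permitted_seed sv /=.
  by apply/implyP => _; apply/forallP.
rewrite negb_forall => /existsP[w]; rewrite negb_imply => /andP[sw nb].
by exists w; apply/orP; right; rewrite /permitted_seed sw (negbTE nb).
Qed.

Lemma best_neq_nil p U : U != [::] -> best p U != [::].
Proof.
case: U => // x0 U' _; set U := x0 :: U'.
have ex : exists m, has (fun x => coord p x == m) U.
  by exists (coord p x0); rewrite /= eqxx.
case: (ex_minnP ex) => m /hasP[x xU /eqP mx] minm.
rewrite -has_filter; apply/hasP; exists x => //; apply/allP => y yU.
by rewrite mx; apply: minm; apply/hasP; exists y.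
Qed.

Lemma outcomes_neq_nil P : outcomes P != [::].
Proof.
move: {2}#|_| (erefl #|white (col P)|) => k.
elim: k P => [|k IH] P E; first by rewrite /outcomes E.
rewrite outcomesE; case: ifPn => // /legal_move_exists[v lv].
apply: best_neq_nil.
have H : outcomes (play P v) != [::].
  apply: IH; move: E.
  by rewrite (card_white_paint (turn P) (legal_move_white lv)) => -[].
case O: (outcomes (play P v)) H => [//|x s] _.
have : x \in flatten [seq outcomes (play P v)
                     | v <- enum (legal_move (col P) (turn P))].
  by apply/flatten_mapP; exists v; rewrite ?mem_enum // O mem_head.
by case: (flatten _).
Qed.

End Game.

(* The default value 0 is only reached for the empty sequence. *)
Definition seq_min (s : seq nat) : nat := foldr minn (head 0 s) s.

(* The game is meant for connected graphs with at least one edge; the cycles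
   satisfy this by the two lemmas below. *)
Definition Zg (G : sgraph) : nat :=
  seq_min [seq x.1 + x.2 | x <- outcomes (initial G)].

Lemma cycle_graph_connected n : connected_graph (cycle_graph n).
Proof.
case: n => [|n]; first by case.
have to0 (i : 'I_n.+1) : connect (@cycle_adj n.+1) ord0 i.
  case: i => k; elim: k => [|k IH] lt.
    by rewrite (_ : Ordinal _ = ord0) ?connect0 //; apply: val_inj.
  apply: connect_trans (IH (ltnW lt)) (connect1 _).
  rewrite /cycle_adj /= -3!val_eqE /= neq_ltn ltnSn /=.
  by rewrite modn_small ?eqxx.
move=> u v; apply: connect_trans (to0 v).
by rewrite (sym_connect_sym (@cycle_adj_sym _)) to0.
Qed.

Lemma cycle_graph_has_edge n : 3 <= n -> has_edge (cycle_graph n).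
Proof.
case: n => [|[|n]] // _; exists ord0, (ordS ord0).
by apply/andP; split; rewrite ?eqxx // -val_eqE /= modn_small.
Qed.

(* Main.v *)
Require Import Defs.
From mathcomp Require Import all_boot.
From mathcomp Require Import zify.

(** Neither player owns a coloured vertex before his first move, so both must
  open with a seed move and every outcome is at least (1, 1) in both
  coordinates.  If Bob answers Alice's first vertex with a neighbour of it, the
  white vertices form a path with a blue vertex at one end and a red vertex at
  the other; each player can then extend his side by a force until the cycle is
  full, which realizes (1, 1).  As (1, 1) is minimal in both coordinates among
  all plays, it survives every optimization along this line of play. *)

Set Implicit Arguments.
Unset Strict Implicit.
Unset Printing Implicit Defensive.

Section Outcomes.
Variable G : sgraph.
Implicit Types (P : position G) (c : colouring G) (p : player) (v : G).

Lemma outcomes_playP P x : ~~ terminal P -> x \in outcomes P ->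
  exists2 v, legal_move (col P) (turn P) v & x \in outcomes (play P v).
Proof.
move=> /negbTE nt; rewrite outcomesE nt mem_filter => /andP[_].
by case/flatten_mapP => v; rewrite mem_enum; exists v.
Qed.

(** Some optimal pair exists because [outcomes P] is nonempty, and a candidate doing at least as
    well for the mover is optimal too. So [x] need only be compared with the optimal pairs, not with
    the results of all moves. *)
Lemma mem_outcomes_play P v x :
  legal_move (col P) (turn P) v -> x \in outcomes (play P v) ->
  (forall y, y \in outcomes P -> coord (turn P) x <= coord (turn P) y) ->
  x \in outcomes P.
Proof.
move=> lv xO le_x.
have nt : terminal P = false.
  by apply/negP => /forallP/(_ v); rewrite (legal_move_white lv).
have: outcomes P != [::] := outcomes_neq_nil P.
move: le_x; rewrite outcomesE nt; set U := flatten _ => le_x.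
have xU : x \in U by apply/flatten_mapP; exists v; rewrite ?mem_enum.
case O: (best _ _) => [//|y s] _.
have yB : y \in best (turn P) U by rewrite O mem_head.
rewrite -O mem_filter xU andbT; apply/allP => z zU.
apply: leq_trans (le_x y yB) _.
by move: yB; rewrite mem_filter => /andP[/allP/(_ z zU)].
Qed.

Lemma outcomes_ge_seeds P x :
  x \in outcomes P -> (seedsA P <= x.1) && (seedsB P <= x.2).
Proof.
rewrite /outcomes; move: #|white (col P)| => k; elim: k P => [|k IH] P /=.
  by rewrite inE => /eqP->; rewrite !leqnn.
rewrite mem_filter => /andP[_ /flatten_mapP[v _ /IH /= /andP[leA leB]]].
by rewrite (leq_trans _ leA) ?(leq_trans _ leB) ?leq_addr.
Qed.

(** Seed counts never decrease, so the present counts bound every outcome below in both coordinates;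
    whoever moves cannot improve on them. *)
Lemma seeds_in_outcomes_force P v : force_move (col P) (turn P) v ->
  (seedsA P, seedsB P) \in outcomes (play P v) ->
  (seedsA P, seedsB P) \in outcomes P.
Proof.
move=> fv xO; apply: mem_outcomes_play xO _; first by rewrite /legal_move fv.
by move=> y /outcomes_ge_seeds/andP[]; case: (turn P).
Qed.

Lemma force_moveN c p v : (forall u, c u != Some p) -> force_move c p v = false.
Proof.
by move=> nc; apply/existsP => -[u /andP[cu _]]; rewrite (negbTE (nc u)) in cu.
Qed.

Lemma terminal_initial : 0 < #|G| -> ~~ terminal (initial G).
Proof.
by case/card_gt0P => v _; apply/forallPn; exists v; rewrite /white ffunE negbK.
Qed.

Lemma play_initialE v :
  play (initial G) v = Position (paint (initial G).(col) Alice v) Bob 1 0.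
Proof.
rewrite /play /= /seed_move force_moveN ?andbT => [|u]; last by rewrite ffunE.
by rewrite /white ffunE eqxx.
Qed.

(** A second vertex leaves Bob something to colour, and with no red vertex on the board his reply
    can only be a seed move. *)
Lemma outcomes_second_ge v x : 1 < #|G| ->
  x \in outcomes (play (initial G) v) -> (0 < x.1) && (0 < x.2).
Proof.
move=> G1; rewrite play_initialE => /outcomes_playP[|w].
  have /card_gt0P[w wv] : 0 < #|predC1 v| by rewrite cardC1; case: #|G| G1 => [|[]].
  by apply/forallPn; exists w; rewrite /white !ffunE (negbTE wv).
move=> /legal_move_white /= ww /outcomes_ge_seeds.
rewrite /= /seed_move ww force_moveN // => u.
by rewrite !ffunE; case: ifP.
Qed.

Lemma outcomes_initial_ge x : 1 < #|G| ->
  x \in outcomes (initial G) -> (0 < x.1) && (0 < x.2).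
Proof.
move=> G1 /outcomes_playP[|v _]; first exact/terminal_initial/ltnW.
exact: outcomes_second_ge.
Qed.

End Outcomes.

Lemma seq_min_eq (s : seq nat) m :
  m \in s -> (forall k, k \in s -> m <= k) -> seq_min s = m.
Proof.
rewrite /seq_min => ms le_m; apply/eqP; rewrite eqn_leq; apply/andP; split.
  elim: s (head 0 s) ms {le_m} => //= k s IH d; rewrite inE geq_min.
  by case/orP => [/eqP->|/IH->]; rewrite ?leqnn ?orbT.
(* The fold starts at [head 0 s]; membership of [m] rules out the empty list and hence the default
   0. *)
have: m <= head 0 s by case: s ms le_m => // k s _; apply; rewrite mem_head.
elim: s (head 0 s) le_m {ms} => //= k s IH d le_m md.
rewrite leq_min le_m ?mem_head //=; apply: IH => // j js.
by apply: le_m; rewrite inE js orbT.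
Qed.

Section Cycle.
Variable n : nat.
Hypothesis n3 : 3 <= n.
Local Notation C := (cycle_graph n).
Implicit Types (c : colouring C) (i j u v : 'I_n).

Lemma modnS_ord i : i.+1 %% n = if i.+1 == n then 0 else i.+1.
Proof.
case: eqP => [->|]; first by rewrite modnn.
by move=> ne; rewrite modn_small //; have := ltn_ord i; lia.
Qed.

(** Spelling out the wrap-around instead of using the modulus makes adjacency accessible to
    [lia]. *)
Lemma cycle_adjE i j : cycle_adj i j =
  [|| j == i.+1 :> nat, i == j.+1 :> nat,
      (i.+1 == n) && (j == 0 :> nat) | (j.+1 == n) && (i == 0 :> nat)].
Proof.
rewrite /cycle_adj /= -!val_eqE /= !modnS_ord.
have := ltn_ord i; have := ltn_ord j.
by case: (i.+1 =P n); case: (j.+1 =P n) => *; lia.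
Qed.

(* The white vertices are those strictly between l and r; the right end is
   taken modulo n, so that r = n stands for vertex 0. *)
Definition white_gap c l r :=
  [/\ 0 < l < r, r <= n,
      forall i, white c i = (l < i < r),
      forall i, i = l :> nat -> c i = Some Bob &
      forall i, i = r %% n :> nat -> c i = Some Alice].

(** The other neighbour of the blue end lies outside the gap. For [r = n] that neighbour is vertex
    1, which is not white because [0 < l]. *)
Lemma white_gap_Alice c l r v : white_gap c l r -> l < v -> r = v.+1 ->
  force_move c Alice v /\ white_gap (paint c Alice v) l v.
Proof.
move=> [lr rn wc cl cr] lv rv; have vn := ltn_ord v; split; last first.
  split; [lia|lia|move=> i|move=> i il|move=> i].
  - rewrite /white ffunE; case: (i =P v) => [->|/eqP]; first by rewrite ltnn andbF.
    by rewrite -[c i == None]/(white c i) wc -val_eqE /=; lia.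
  - by rewrite ffunE -val_eqE /= il ltn_eqF // cl.
  - by rewrite modn_small // ffunE => /ord_inj ->; rewrite eqxx.
have rE : r %% n = if r == n then 0 else r.
  by case: eqP => [->|ne]; [rewrite modnn | rewrite modn_small; lia].
have rltn : r %% n < n by rewrite ltn_mod; lia.
apply/existsP; exists (Ordinal rltn).
rewrite /legal_force cr // eqxx andTb; apply/eqP/setP => w.
rewrite !inE wc [adj _ _]cycle_adjE -val_eqE /= rE.
by have := ltn_ord w; case: (r =P n) => *; lia.
Qed.

Lemma white_gap_Bob c l r v : white_gap c l r -> v < r -> v = l.+1 :> nat ->
  force_move c Bob v /\ white_gap (paint c Bob v) v r.
Proof.
move=> [lr rn wc cl cr] vr vl; have vn := ltn_ord v; split; last first.
  split; [lia|lia|move=> i|move=> i|move=> i ir].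
  - rewrite /white ffunE; case: (i =P v) => [->|/eqP]; first by rewrite ltnn.
    by rewrite -[c i == None]/(white c i) wc -val_eqE /=; lia.
  - by rewrite ffunE => /ord_inj ->; rewrite eqxx.
  (* The blue end is not repainted: it is already coloured, whereas [v] lies in the white gap. *)
  - rewrite ffunE cr //; case: eqP => // iv.
    have := wc i; rewrite iv /white cr; last by rewrite -iv.
    by rewrite vl ltnSn -vl vr.
have ltn_l : l < n by lia.
apply/existsP; exists (Ordinal ltn_l).
rewrite /legal_force cl // eqxx andTb; apply/eqP/setP => w.
rewrite !inE wc [adj _ _]cycle_adjE -val_eqE /=.
by have := ltn_ord w; lia.
Qed.

Lemma outcomes_white_gap (P : position C) l r : white_gap (col P) l r ->
  (seedsA P, seedsB P) \in outcomes P.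
Proof.
(* Induction on the width of the gap; width 0 is impossible, and at width 1 no white vertex is
   left. *)
move: {2}(r - l) (erefl (r - l)) => d.
elim: d P l r => [|d IH] P l r rl gap.
  by case: gap => lr; lia.
case: (gap) => lr rn wc _ _.
have [d0|d_gt0] := posnP d.
  rewrite outcomesE; have -> : terminal P by apply/forallP => i; rewrite wc; lia.
  exact: mem_head.
(* Alice moves the right end inwards and Bob the left end, so either player has a force. *)
have [v [fv [l' [r' [gap' rl']]]]] : exists v,
    force_move (col P) (turn P) v /\
    exists l' r', white_gap (paint (col P) (turn P) v) l' r' /\ r' - l' = d.
  case: (turn P).
    have vn : r.-1 < n by lia.
    have [||fv gap'] := @white_gap_Alice _ _ _ (Ordinal vn) gap; rewrite /=; try lia.
    by exists (Ordinal vn); split=> //; exists l, r.-1; split=> //; lia.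
  have vn : l.+1 < n by lia.
  have [||fv gap'] := @white_gap_Bob _ _ _ (Ordinal vn) gap; rewrite /=; try lia.
  by exists (Ordinal vn); split=> //; exists l.+1, r; split=> //; lia.
apply: (seeds_in_outcomes_force fv).
by have := IH (play P v) l' r' rl' gap'; rewrite /= /seed_move fv andbF !addn0.
Qed.

Lemma outcome11_initial : (1, 1) \in outcomes (initial C).
Proof.
have lt0 : 0 < n by lia.
have lt1 : 1 < n by lia.
have ltp : n.-1 < n by lia.
have C1 : 1 < #|C| by rewrite card_ord.
pose v0 : C := Ordinal lt0; pose v1 : C := Ordinal lt1.
pose vn : C := Ordinal ltp.
have noF p v : force_move (initial C).(col) p v = false.
  by apply: force_moveN => u; rewrite ffunE.
apply: (@mem_outcomes_play _ _ v0); last first.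
- by move=> y /(outcomes_initial_ge C1)/andP[].
- apply: (@mem_outcomes_play _ _ v1); last first.
  + by move=> y /(outcomes_second_ge C1)/andP[]; rewrite play_initialE.
  + rewrite play_initialE; set P := Position _ _ _ _.
    have w1 : white (col P) v1 by rewrite /white !ffunE.
    have f1 : force_move (col P) Bob v1 = false.
      by apply: force_moveN => u; rewrite !ffunE; case: ifP.
    (* Vertex 1 is the red end, and vertex 0, read as n, is the blue end. *)
    have := @outcomes_white_gap (play P v1) 1 n.
    rewrite /= /seed_move w1 f1 /= => -> //; split=> //.
    * move=> i; rewrite /white !ffunE -!val_eqE /=.
      by have := ltn_ord i; case: (val i) => [|[]].
    * by move=> i i1; rewrite !ffunE -!val_eqE /= i1.
    * by move=> i i0; rewrite !ffunE -!val_eqE /= i0 modnn.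
  rewrite play_initialE /legal_move /permitted_seed /seed_move /=.
  set c := paint _ _ _.
  have -> : force_move c Bob v1 = false.
    by apply: force_moveN => u; rewrite !ffunE; case: ifP.
  have -> : white c v1 by rewrite /white !ffunE.
  (* Alice has no force to block: the only blue vertex, 0, has the white neighbours 1 and n - 1,
     distinct as n is at least 3. *)
  suff /negbTE-> : ~~ blocks c Bob v1 by [].
  apply/existsP => -[u /existsP[w /andP[/andP[cu /eqP/setP E] _]]].
  have u0 : u = v0 by move: cu; rewrite !ffunE; case: (u =P v0).
  have := E v1; have := E vn; rewrite !inE u0 /white !ffunE.
  rewrite ![adj _ _]cycle_adjE -!val_eqE /=.
  have -> : (n.-1 == 0) = false by lia.
  by rewrite !eqxx; lia.
rewrite /legal_move /permitted_seed /seed_move noF /white ffunE /=.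
suff /negbTE-> : ~~ blocks (initial C).(col) Alice v0 by [].
apply/existsP => -[u /existsP[w /andP[/andP[cu _] _]]].
by rewrite ffunE in cu.
Qed.

End Cycle.

Theorem proposition9 (n : nat) (hn : 3 <= n) : Zg (cycle_graph n) = 2.
Proof.
apply: seq_min_eq.
  by apply/mapP; exists (1, 1); first exact: outcome11_initial.
move=> k /mapP[x /outcomes_initial_ge +->].
rewrite card_ord => /(_ (ltnW hn))/andP[x1 x2].
exact: leq_add x1 x2.
Qed.
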